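(* Let $\nu\in\mathbb{R}$, $t>0$ and $n\in\mathbb{N}_0$. The orthogonal polynomials $P_n^\nu(x,t)$ satisfy the first order partial differential-difference equation $$\left( t \frac{\partial}{\partial t} + x \frac{\partial}{\partial x} \right) P_n^\nu(x,t) = \left( t \frac{a_n'(t)}{a_n(t)}+ n \right) P_n^\nu(x,t) + A_n(t) P_{n-1}^\nu(x,t).$$
   Context: $\mathbb{N}_0=\{0,1,2,\dots\}$. For $\nu\in\mathbb{R}$, $t>0$, $\{P_n^\nu(x,t)\}_{n\ge 0}$ is the sequence of polynomials in $x$ with $P_n^\nu$ of degree exactly $n$ and $\int_0^\infty P_n^\nu(x,t)P_m^\nu(x,t)e^{-x-t/x}x^\nu dx=\delta_{n,m}$ for $n,m\in\mathbb{N}_0$; the sign is fixed so that the leading coefficient has sign $(-1)^n$. Write $P_n^\nu(x,t)=\sum_{k=0}^n a_{n,k}(t)x^k$, $a_n(t)=a_{n,n}(t)\neq0$. Put $A_n(t)=a_{n-1}(t)/a_n(t)$ for $n\ge1$, and by convention $P_{-1}^\nu\equiv0$, $A_0=0$. The coefficients $a_{n,k}(t)$ are regarded as continuously differentiable functions of $t>0$; primes denote $d/dt$. *)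

(* Defs.v *)
From HB Require Import structures.
From mathcomp Require Import all_boot all_order all_algebra.
From mathcomp Require Import all_classical all_reals all_analysis.
Set Implicit Arguments.
Unset Strict Implicit.
Unset Printing Implicit Defensive.
Import Order.TTheory GRing.Theory Num.Theory.
Import numFieldNormedType.Exports.
Local Open Scope classical_set_scope.
Local Open Scope ring_scope.

(** Families of polynomials are functions [P : nat -> R -> {poly R}], where
    [P n t] stands for P_n^nu(., t).  Every condition below is imposed for
    [0 < t] only; the values of [P] at other [t] are irrelevant. *)

Definition weight (R : realType) (nu t x : R) : R :=
  expR (- x - t / x) * x `^ nu.

Definition orthonormal_family (R : realType) (nu : R)
    (P : nat -> R -> {poly R}) : Prop :=
  forall t : R, 0 < t ->
    [/\ forall n : nat, size (P n t) = n.+1,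
        forall n m : nat,
          (\int[@lebesgue_measure R]_(x in `]0%R, +oo[)
             ((P n t).[x] * (P m t).[x] * weight nu t x)%:E)%E
          = ((n == m)%:R)%:E
      & forall n : nat, Num.sg (lead_coef (P n t)) = (-1) ^+ n].

Definition coef_fun (R : realType) (P : nat -> R -> {poly R}) (n k : nat)
  (t : R) : R := (P n t)`_k.

Definition top_coef (R : realType) (P : nat -> R -> {poly R}) (n : nat) :
  R -> R := coef_fun P n n.

Definition C1_coefs (R : realType) (P : nat -> R -> {poly R}) : Prop :=
  forall (n k : nat) (t : R), (k <= n)%N -> 0 < t ->
    derivable (coef_fun P n k) t 1 /\
    {for t, continuous (derive1 (coef_fun P n k))}.

(** [prevP P n] is P_{n-1} and [ratioA P n] is A_n; the first branches are the
    conventions P_{-1} = 0 and A_0 = 0. *)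
Definition prevP (R : realType) (P : nat -> R -> {poly R}) (n : nat) (t : R) :
    {poly R} :=
  match n with 0%N => 0 | m.+1 => P m t end.

Definition ratioA (R : realType) (P : nat -> R -> {poly R}) (n : nat) (t : R) :
    R :=
  match n with 0%N => 0 | m.+1 => top_coef P m t / top_coef P m.+1 t end.

(* Main.v *)
Require Import Defs.
From HB Require Import structures.
From mathcomp Require Import all_boot all_order all_algebra.
From mathcomp Require Import all_classical all_reals all_analysis.
From mathcomp Require Import measurable_realfun ring lra.
Set Implicit Arguments.
Unset Strict Implicit.
Unset Printing Implicit Defensive.
Import Order.TTheory GRing.Theory Num.Theory.
Import numFieldNormedType.Exports.
Local Open Scope classical_set_scope.
Local Open Scope ring_scope.

(** Why the theorem holds.  Write [L_t p] for the integral of [p.[x]] against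
    the weight [w_t x = e^(-x - t/x) x^nu] over the positive half-line.

    The substitution [x = t y] turns the [k]-th moment into
    [t^(k+nu+1)] times the Laplace transform at [t] of
    [y^k e^(-1/y) y^nu]: the singular factor [e^(-t/x)] no longer depends on
    [t].  Differentiating under the integral sign ([is_derive_laplace]) gives
    the moment equation ([is_derive_moment])
      [t d/dt L_t(x^k) = (k + nu + 1) L_t(x^k) - L_t(x^(k+1))],
    hence, for a polynomial [p] whose coefficients depend on [t]
    ([is_derive_wint]),
      [t d/dt L_t(p) = L_t(D p) + (nu + 1) L_t(p) - L_t(x p)]
    where [D = t d/dt + x d/dx].  The Euler operator [D] is a derivation that
    preserves the degree bound.

    Apply this to [p = P_n P_m] with [m < n].  The left-hand side vanishes,
    since [L_t(P_n P_m) = 0] for all [t]; on the right, [L_t(P_n (D P_m)) = 0]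
    because [D P_m] has degree at most [m].  What remains is
    [L_t((D P_n) P_m) = L_t(P_n (x P_m))] ([wint_eulerD]), which is [A_n] for
    [m = n - 1] and zero for [m < n - 1].  So
    [D P_n - (t a_n'/a_n + n) P_n - A_n P_(n-1)] is orthogonal to all [P_m] with
    [m < n]; its coefficient of degree [n] vanishes as well, so it is zero
    ([eulerDE]).

    All moments are finite because the [P_n] have finite norms
    ([orthonormal_finite_moments]). *)

(** * Dilations of Lebesgue measure and Laplace transforms *)

Section Scaling.
Context {R : realType}.
Local Notation mu := (@lebesgue_measure R).
Local Notation posR := (`]0%R, +oo[%classic : set (measurableTypeR R)).

Lemma measurable_dilation (c : R) :
  measurable_fun setT ( *%R c : measurableTypeR R -> measurableTypeR R).
Proof. by []. Qed.

(** Bundled with its measure structure, since the measurability of the dilation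
    is not inferred from the pushforward function alone. *)
Definition dilated_lebesgue (c : R) : {measure set (measurableTypeR R) -> \bar R} :=
  measure_function_pushforward__canonical__measure_function_Measure mu
    (measurable_dilation c).

(** The dilated measure gives an interval its length divided by [c];
    multiplying by [c] restores Lebesgue measure on intervals, hence on all
    measurable sets. *)
Lemma lebesgue_measure_scale (c : {nonneg R}) (A : set R) :
  0 < c%:num -> measurable A -> mu A = mscale c (dilated_lebesgue c%:num) A.
Proof.
move=> c0 mA.
apply: (@lebesgue_measure_unique _ (mscale c (dilated_lebesgue c%:num))) => //.
move=> _ [[a b] _ <-].
rewrite /= [RHS]/mscale/= /pushforward.
have -> : *%R c%:num @^-1` `]a, b] = `](a / c%:num), (b / c%:num)]%classic.
  apply/seteqP; split=> x /=; rewrite !in_itv/= ltr_pdivrMr// ler_pdivlMr// mulrC//.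
rewrite !lebesgue_measure_itv/= !lte_fin ltr_pM2r ?invr_gt0//.
case: ifP => _; last by rewrite mule0.
by rewrite -!EFinB -EFinM -mulrBl mulrC divfK// gt_eqF.
Qed.

(** The image measure is used rather than a substitution rule for continuous
    integrands, because the weight may be discontinuous at [0]. *)
Lemma ge0_integral_scale (c : R) (f : R -> \bar R) : 0 < c ->
  measurable_fun posR f ->
  (forall x, 0 < x -> (0 <= f x)%E) ->
  (\int[mu]_(x in posR) f x =
   c%:E * \int[mu]_(y in posR) f (c * y)%R)%E.
Proof.
move=> c0 mf f0.
have f0' x : posR x -> (0 <= f x)%E.
  by rewrite /= in_itv/= andbT; exact: f0.
pose c' : {nonneg R} := NngNum (ltW c0).
rewrite (eq_measure_integral (mscale c' (dilated_lebesgue c))); last first.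
  by move=> A mA _; apply: (@lebesgue_measure_scale c').
rewrite ge0_integral_mscale//; congr (_ * _)%E.
rewrite ge0_integral_pushforward//; last by move=> y; rewrite inE; exact: f0'.
congr (integral mu _ _).
by apply/seteqP; split=> x /=; rewrite !in_itv/= !andbT pmulr_rgt0.
Qed.

(** For [s] in [(t/2, 2t)] the derivative of the integrand in [s] is dominated by
    its absolute value at [s = t/2], which is integrable. *)
Lemma is_derive_laplace (g : R -> R) (t : R) : 0 < t ->
  (forall s, 0 < s ->
    mu.-integrable posR (EFin \o (fun y => expR (- (s * y)) * g y))) ->
  (forall s, 0 < s ->
    mu.-integrable posR
      (EFin \o (fun y => expR (- (s * y)) * (y * g y)))) ->
  is_derive t (1:R)
    (fun s => \int[mu]_(y in posR) (expR (- (s * y)) * g y))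
    (- \int[mu]_(y in posR) (expR (- (t * y)) * (y * g y))).
Proof.
move=> t0 ig iyg.
pose f (s y : R) := expR (- (s * y)) * g y.
have df s y : is_derive s (1:R) (f ^~ y) (- (expR (- (s * y)) * (y * g y))).
  rewrite /f; apply: is_derive_eq.
  by rewrite !(scaler0,addr0,add0r)/GRing.scale/=; ring.
have d1E s y : partial1of2 f s y = - (expR (- (s * y)) * (y * g y)).
  by rewrite partial1of2E; exact: derive_val.
have th0 : 0 < t / 2 by rewrite divr_gt0.
have It : `](t / 2), (t * 2)[%classic t.
  by rewrite /= in_itv/=; apply/andP; split; lra.
have intf s : `](t / 2), (t * 2)[%classic s ->
    mu.-integrable posR (EFin \o f s).
  by rewrite /= in_itv/= => /andP[ts _]; apply: ig; exact: lt_trans ts.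
have derf (s y : R) : `](t / 2), (t * 2)[%classic s -> posR y ->
    derivable (f ^~ y) s 1.
  by move=> _ _; exact: ex_derive.
pose G y := `|expR (- (t / 2 * y)) * (y * g y)|.
have intG : mu.-integrable posR (EFin \o G).
  exact: (integrable_norm (iyg _ th0)).
have G_ub (s y : R) : `](t / 2), (t * 2)[%classic s -> posR y ->
    `|partial1of2 f s y| <= G y.
  rewrite /= !in_itv/= andbT => /andP[ts _] y0; rewrite d1E normrN /G !normrM.
  rewrite ler_wpM2r// ?mulr_ge0// !ger0_norm ?expR_ge0// ler_expR lerN2.
  by rewrite ler_wpM2r// ltW.
have G0 y : 0 <= G y by exact: normr_ge0.
have mD : measurable posR by [].
split.
  exact: (derivable_under_integral (mu := mu) mD It intf derf G0 intG G_ub).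
have := differentiation_under_integral (mu := mu) mD It intf derf G0 intG G_ub.
rewrite derive1E => ->.
rewrite -mulN1r -RintegralZl//; last exact: iyg.
apply: eq_Rintegral => y _.
by rewrite -[LHS]/(partial1of2 f t y) d1E mulN1r.
Qed.

End Scaling.

(** * Moments of the weight *)

Section Moments.
Context {R : realType}.
Local Notation mu := (@lebesgue_measure R).
Local Notation posR := (`]0%R, +oo[%classic : set (measurableTypeR R)).

Lemma measurable_invr_pos : measurable_fun posR (fun x : R => x^-1).
Proof.
(* on positive reals the inverse is a power function, known to be measurable *)
apply: (eq_measurable_fun (fun x : R => x `^ (-1))).
  move=> x; rewrite inE/= in_itv/= andbT => x0.
  by rewrite powR_inv1// ltW.
by apply: measurable_funTS; exact: measurable_powR.
Qed.

Lemma measurable_weight (nu t : R) : measurable_fun posR (weight nu t).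
Proof.
apply: measurable_funM; last by apply: measurable_funTS; exact: measurable_powR.
apply: measurableT_comp => //; apply: measurable_funB => //.
by apply: measurable_funM => //; exact: measurable_invr_pos.
Qed.

Lemma measurable_polyM (f : R -> R) (p : {poly R}) :
  measurable_fun posR f -> measurable_fun posR (fun x => p.[x] * f x).
Proof.
move=> mf; apply: measurable_funM => //; apply: measurable_funTS.
by apply: continuous_measurable_fun; exact: continuous_horner.
Qed.

Definition wint (nu t : R) (p : {poly R}) : R :=
  \int[mu]_(x in posR) (p.[x] * weight nu t x).

Definition finite_moments (nu t : R) :=
  forall p : {poly R},
    mu.-integrable posR (EFin \o (fun x => p.[x] * weight nu t x)).

Lemma wint_linear (nu t : R) : finite_moments nu t ->
  forall (c : R) (p q : {poly R}),
    wint nu t (c *: p + q) = c * wint nu t p + wint nu t q.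
Proof.
move=> fm c p q; rewrite /wint -RintegralZl//.
rewrite -RintegralD//; last first.
  apply: eq_integrable (integrableZl _ c (fm p)) => //.
by apply: eq_Rintegral => x _; rewrite hornerD hornerZ; ring.
Qed.

Lemma wint0 (nu t : R) : finite_moments nu t -> wint nu t 0 = 0.
Proof.
move=> fm; have := wint_linear fm (-1) 0 0.
by rewrite scaler0 addr0 => ->; ring.
Qed.

(** The factor of the weight that no longer depends on [t] once [x = t * y]. *)
Definition reduced_weight (nu y : R) : R := expR (- y^-1) * y `^ nu.

Lemma weight_scale (nu t y : R) : 0 < t -> 0 < y ->
  weight nu t (t * y) = t `^ nu * (expR (- (t * y)) * reduced_weight nu y).
Proof.
move=> t0 y0; rewrite /weight /reduced_weight powRM ?ltW// expRD.
have -> : t / (t * y) = y^-1 by rewrite invfM mulrA divff ?gt_eqF// mul1r.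
by ring.
Qed.

Lemma measurable_reduced (nu t : R) (k : nat) :
  measurable_fun posR
    (fun y : R => expR (- (t * y)) * (y ^+ k * reduced_weight nu y)).
Proof.
apply: measurable_funM.
  by apply: measurableT_comp => //; exact: measurableT_comp.
apply: measurable_funM => //.
apply: measurable_funM; last by apply: measurable_funTS; exact: measurable_powR.
by do 2 apply: measurableT_comp => //; exact: measurable_invr_pos.
Qed.

(** This identity of extended reals yields both the finiteness and the value of
    the integral on the right. *)
Lemma ge0_integral_moment_scale (nu t : R) (k : nat) : 0 < t ->
  (\int[mu]_(x in posR) (x ^+ k * weight nu t x)%:E =
   (t `^ (k%:R + nu + 1))%:E *
    \int[mu]_(y in posR) (expR (- (t * y)) * (y ^+ k * reduced_weight nu y))%:E)%E.
Proof.
move=> t0.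
have w0 x : 0 <= weight nu t x by rewrite mulr_ge0 ?expR_ge0 ?powR_ge0.
have mf : measurable_fun posR (fun x : R => (x ^+ k * weight nu t x)%:E).
  apply/measurable_EFinP.
  rewrite [X in measurable_fun _ X](_ : _ =
      (fun x : R => ('X^k : {poly R}).[x] * weight nu t x)).
    by apply: measurable_polyM; exact: measurable_weight.
  by apply/funext => x; rewrite hornerXn.
rewrite (ge0_integral_scale t0)//; last first.
  by move=> x x0; rewrite lee_fin mulr_ge0// exprn_ge0// ltW.
under eq_integral => y.
  rewrite inE/= in_itv/= andbT => y0.
  rewrite weight_scale// (_ : _ * _ = t `^ (k%:R + nu) *
      (expR (- (t * y)) * (y ^+ k * reduced_weight nu y))); last first.
    rewrite exprMn powRD; last by rewrite (gt_eqF t0) implybT.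
    by rewrite powR_mulrn ?ltW//; ring.
  rewrite EFinM.
  over.
rewrite ge0_integralZl//; last 3 first.
- by apply/measurable_EFinP; exact: measurable_reduced.
- move=> y; rewrite /= in_itv/= andbT => y0.
  by rewrite lee_fin !mulr_ge0 ?expR_ge0 ?powR_ge0// exprn_ge0// ltW.
- by rewrite lee_fin powR_ge0.
rewrite muleA -EFinM; congr (_%:E * _)%E.
by rewrite [RHS]powRD ?(gt_eqF t0) ?implybT// powRr1 ?ltW// mulrC.
Qed.

Lemma integrable_reduced (nu t : R) (k : nat) : 0 < t -> finite_moments nu t ->
  mu.-integrable posR
    (EFin \o (fun y => expR (- (t * y)) * (y ^+ k * reduced_weight nu y))).
Proof.
move=> t0 fm; apply/integrableP; split.
  by apply/measurable_EFinP; exact: measurable_reduced.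
under eq_integral => y.
  rewrite inE/= in_itv/= andbT => y0.
  rewrite ger0_norm; last first.
    by rewrite !mulr_ge0 ?expR_ge0 ?powR_ge0// exprn_ge0// ltW.
  over.
have mD : measurable posR by [].
have := integrable_lty mD (fm 'X^k).
rewrite /comp; under eq_integral do rewrite hornerXn.
rewrite ge0_integral_moment_scale//.
case: (integral _ _ _) => [r _| |//]; first exact: ltry.
by rewrite gt0_muley// lte_fin powR_gt0.
Qed.

Lemma moment_scale (nu t : R) (k : nat) : 0 < t -> finite_moments nu t ->
  wint nu t 'X^k = t `^ (k%:R + nu + 1) *
    \int[mu]_(y in posR) (expR (- (t * y)) * (y ^+ k * reduced_weight nu y)).
Proof.
move=> t0 fm; rewrite /wint /Rintegral.
under eq_integral do rewrite hornerXn.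
rewrite ge0_integral_moment_scale// fineM//.
exact/integrable_fin_num/integrable_reduced.
Qed.

(** The two terms come from the power of [t] and from the Laplace transform in
    [moment_scale]. *)
Lemma is_derive_moment (nu t : R) (k : nat) : 0 < t ->
  (forall s, 0 < s -> finite_moments nu s) ->
  is_derive t (1 : R) (fun s => wint nu s 'X^k)
    (t^-1 * ((k%:R + nu + 1) * wint nu t 'X^k - wint nu t 'X^(k.+1))).
Proof.
move=> t0 fm.
pose G j s :=
  \int[mu]_(y in posR) (expR (- (s * y)) * (y ^+ j * reduced_weight nu y)).
apply: (@near_eq_is_derive _ _ _ (fun s => s `^ (k%:R + nu + 1) * G k s)).
  near=> s; have s0 : 0 < s by near: s; exact: lt_nbhsr.
  by rewrite moment_scale//; exact: fm.
have dG : is_derive t (1 : R) (G k) (- G k.+1 t).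
  have : - G k.+1 t = - \int[mu]_(y in posR)
      (expR (- (t * y)) * (y * (y ^+ k * reduced_weight nu y))).
    by congr (- _); apply: eq_Rintegral => y _; rewrite exprS !mulrA.
  move=> ->; apply: is_derive_laplace => // s s0.
    by apply: integrable_reduced => //; exact: fm.
  apply: eq_integrable (integrable_reduced k.+1 s0 (fm _ s0)) => //.
  by move=> y _ /=; rewrite exprS !mulrA.
apply: is_derive_eq; first exact: (is_deriveM (is_derive1_powR _ t0) dG).
rewrite !moment_scale//; [|exact: fm..].
rewrite -!/(G _ _) /GRing.scale/=.
have -> : k.+1%:R + nu + 1 = (k%:R + nu + 1) + 1 by rewrite -natr1; ring.
have powRS a : t `^ (a + 1) = t `^ a * t.
  by rewrite powRD ?(gt_eqF t0) ?implybT// powRr1 ?ltW.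
rewrite powRB ?(gt_eqF t0) ?implybT// !powRS powRr1 ?ltW//.
by field; rewrite gt_eqF.
Unshelve. all: by end_near. Qed.

End Moments.

(** * Sequences of polynomials of degrees 0, 1, 2, ... *)

Section GradedPoly.
Variables (F : fieldType) (P : nat -> {poly F}).
Hypothesis sizeP : forall n, size (P n) = n.+1.

Lemma graded_coef_neq0 n : (P n)`_n != 0.
Proof.
have : lead_coef (P n) != 0 by rewrite lead_coef_eq0 -size_poly_eq0 sizeP.
by rewrite lead_coefE sizeP.
Qed.

Lemma size_cancel_top (n : nat) (p : {poly F}) : (size p <= n.+1)%N -> p`_n = 0 ->
  (size p <= n)%N.
Proof.
move=> sp p0; apply/leq_sizeP => j; rewrite leq_eqVlt => /predU1P[<-//|nj].
by move/leq_sizeP : sp; exact.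
Qed.

Lemma size_sub_top (n : nat) (p : {poly F}) : (size p <= n.+1)%N ->
  (size (p - (p`_n / (P n)`_n) *: P n)%R <= n)%N.
Proof.
move=> sp; apply: size_cancel_top; last first.
  by rewrite coefB coefZ divfK ?subrr// graded_coef_neq0.
rewrite (leq_trans (size_polyD _ _))// geq_max sp/= size_polyN.
by rewrite (leq_trans (size_scale_leq _ _))// sizeP.
Qed.

(** The polynomials [P i] with [i < n] span the polynomials of degree less than
    [n]; stated as an induction principle over linear predicates, so that it
    serves both for integrability and for orthogonality. *)
Lemma graded_poly_ind (S : {poly F} -> Prop) : S 0 ->
  (forall c p q, S p -> S q -> S (c *: p + q)) ->
  forall n, (forall i, (i < n)%N -> S (P i)) ->
  forall p : {poly F}, (size p <= n)%N -> S p.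
Proof.
move=> S0 Slin; elim=> [_ p|n ih SP p sp].
  by rewrite leqn0 size_poly_eq0 => /eqP->.
rewrite -[p](subrK ((p`_n / (P n)`_n) *: P n)) addrC.
apply: Slin; first exact: SP.
by apply: ih (size_sub_top sp) => i ni; apply: SP; rewrite ltnS ltnW.
Qed.

End GradedPoly.

(** * Polynomials with differentiable coefficients *)

Section CoefDerive.
Context {R : realType}.
Implicit Types (p : R -> {poly R}) (q : {poly R}).

Definition coef_derive p (t : R) q :=
  forall k, is_derive t (1 : R) (fun s => (p s)`_k) q`_k.

Lemma coef_deriveM p1 p2 t q1 q2 : coef_derive p1 t q1 -> coef_derive p2 t q2 ->
  coef_derive (fun s => p1 s * p2 s) t (q1 * p2 t + p1 t * q2).
Proof.
move=> d1 d2 k.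
rewrite (_ : (fun s => _) =
    \sum_(i < k.+1)
      ((fun s => (p1 s)`_i) * (fun s => (p2 s)`_(k - i)))); last first.
  by apply/funext => s; rewrite coefM fct_sumE.
apply: is_derive_eq.
  by apply: is_derive_sum => i; apply: is_deriveM; [exact: d1|exact: d2].
rewrite coefD !coefM -big_split/=; apply: eq_bigr => i _.
by rewrite /GRing.scale/=; ring.
Qed.

Variables (p : R -> {poly R}) (t : R) (q : {poly R}) (N : nat).
Hypotheses (t0 : 0 < t) (sp : forall s : R, 0 < s -> (size (p s) <= N)%N)
  (dp : coef_derive p t q).

(** A coefficient that vanishes for all positive [s] has derivative zero at [t]. *)
Lemma size_coef_derive : (size q <= N)%N.
Proof.
apply/leq_sizeP => k Nk.
have d0 : is_derive t (1 : R) (fun s => (p s)`_k) 0.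
  apply: (@near_eq_is_derive _ _ _ (cst 0)).
  near=> s; have s0 : 0 < s by near: s; exact: lt_nbhsr.
  by have /leq_sizeP-> := sp s0.
by rewrite -(@derive_val _ _ _ _ _ _ _ (dp k)) derive_val.
Unshelve. all: by end_near. Qed.

(** Leibniz rule for functionals [F s] linear in the coefficients: both
    evaluation at a point and integration against the weight are of this form. *)
Lemma is_derive_coef_sum (f : nat -> R -> R) (df : nat -> R)
    (F : R -> {poly R} -> R) :
  (forall k, is_derive t (1 : R) (f k) (df k)) ->
  (forall (s : R) (u : {poly R}), 0 < s -> (size u <= N)%N ->
     F s u = \sum_(k < N) u`_k * f k s) ->
  is_derive t (1 : R) (fun s => F s (p s))
    (F t q + \sum_(k < N) (p t)`_k * df k).
Proof.
move=> fdf FE.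
apply: (@near_eq_is_derive _ _ _ (\sum_(k < N) ((fun s => (p s)`_k) * f k))).
  near=> s; have s0 : 0 < s by near: s; exact: lt_nbhsr.
  by rewrite FE ?sp// fct_sumE.
apply: is_derive_eq.
  by apply: is_derive_sum => i; apply: is_deriveM; exact: dp.
rewrite FE ?size_coef_derive// -big_split/=; apply: eq_bigr => i _.
by rewrite /GRing.scale/=; ring.
Unshelve. all: by end_near. Qed.

Lemma is_derive_horner_coef (x : R) :
  is_derive t (1 : R) (fun s => (p s).[x]) q.[x].
Proof.
apply: is_derive_eq.
  apply: (is_derive_coef_sum (F := fun _ u => u.[x]) (f := fun k => cst (x ^+ k))).
  by move=> s u _ su; rewrite (horner_coef_wide _ su).
by rewrite big1 ?addr0// => i _; rewrite mulr0.
Qed.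

End CoefDerive.

(** * Differentiating the integral of a polynomial against the weight *)

Section WeightedIntegral.
Context {R : realType}.
Local Notation mu := (@lebesgue_measure R).
Local Notation posR := (`]0%R, +oo[%classic : set (measurableTypeR R)).
Implicit Types (nu t : R) (p q : {poly R}).

Lemma wint_sum nu t : finite_moments nu t ->
  forall N (c : nat -> R) (f : nat -> {poly R}),
    wint nu t (\sum_(k < N) c k *: f k) = \sum_(k < N) c k * wint nu t (f k).
Proof.
move=> fm; elim=> [|N ih] c f; last first.
  by rewrite !big_ord_recr/= addrC wint_linear// ih addrC.
by rewrite !big_ord0 wint0.
Qed.

Lemma poly_wide p N : (size p <= N)%N -> p = \sum_(k < N) p`_k *: 'X^k.
Proof.
move=> sp; rewrite -poly_def; apply/polyP => k; rewrite coef_poly.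
by case: ltnP => // Nk; rewrite (leq_sizeP _ _ sp).
Qed.

Lemma wint_wide nu t p N : finite_moments nu t -> (size p <= N)%N ->
  wint nu t p = \sum_(k < N) p`_k * wint nu t 'X^k.
Proof.
move=> fm sp; rewrite [in LHS](poly_wide sp).
exact: (wint_sum fm _ (fun k => p`_k) (fun k => 'X^k)).
Qed.

(** Summing [is_derive_moment] over the monomials of [p t]: the factor [k] of the
    [k]-th moment is the action of [x d/dx]. *)
Lemma is_derive_wint nu t (N : nat) (p : R -> {poly R}) q : 0 < t ->
  (forall s, 0 < s -> finite_moments nu s) ->
  (forall s, 0 < s -> (size (p s) <= N)%N) -> coef_derive p t q ->
  is_derive t (1 : R) (fun s => wint nu s (p s))
    (wint nu t q + t^-1 * (wint nu t ('X * (p t)^`())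
       + (nu + 1) * wint nu t (p t) - wint nu t ('X * p t))).
Proof.
move=> t0 fm sp dp; have fmt := fm _ t0; have spt := sp _ t0.
apply: is_derive_eq.
  apply: (is_derive_coef_sum (F := wint nu) (f := fun k s => wint nu s 'X^k)
            t0 sp dp).
    by move=> k; exact: is_derive_moment.
  by move=> s u s0 su; rewrite (wint_wide _ su)//; exact: fm.
congr (_ + _).
have XdE k : ('X * (p t)^`())`_k = (p t)`_k * k%:R.
  by rewrite coefXM; case: k => [|k] /=; rewrite ?mulr0// coef_deriv mulr_natr.
have sXd : (size ('X * (p t)^`())%R <= N)%N.
  by apply/leq_sizeP => j Nj; rewrite XdE (leq_sizeP _ _ spt)// mul0r.
have -> : 'X * p t = \sum_(k < N) (p t)`_k *: 'X^(k.+1).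
  rewrite {1}(poly_wide spt) mulr_sumr; apply: eq_bigr => k _.
  by rewrite -scalerAr exprS.
rewrite (wint_sum fmt _ (fun k => (p t)`_k) (fun k => 'X^(k.+1))).
rewrite (wint_wide fmt sXd) (wint_wide fmt spt).
rewrite mulr_sumr -big_split/= -sumrB mulr_sumr; apply: eq_bigr => k _.
by rewrite XdE; ring.
Qed.

End WeightedIntegral.

(** * Orthonormal families *)

Section Orthonormal.
Context {R : realType}.
Local Notation mu := (@lebesgue_measure R).
Local Notation posR := (`]0%R, +oo[%classic : set (measurableTypeR R)).
Variables (nu : R) (P : nat -> R -> {poly R}).
Hypothesis hP : orthonormal_family nu P.

(** The squares [P_n^2] are integrable, having norm 1; so is the constant [1], a
    multiple of [P_0^2], and then [P_n], bounded by [1 + P_n^2]; the [P_n] span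
    all polynomials. *)
Lemma orthonormal_finite_moments t : 0 < t -> finite_moments nu t.
Proof.
move=> t0 p; have [sP oP _] := hP t0.
have w0 x : 0 <= weight nu t x by rewrite mulr_ge0 ?expR_ge0 ?powR_ge0.
have mpw q : measurable_fun posR (EFin \o (fun x => q.[x] * weight nu t x)).
  by apply/measurable_EFinP; apply: measurable_polyM; exact: measurable_weight.
have i2 n : mu.-integrable posR
    (EFin \o (fun x => (P n t ^+ 2).[x] * weight nu t x)).
  apply/integrableP; split; first exact: mpw.
  under eq_integral => x _.
    rewrite /comp abse_EFin ger0_norm; last by rewrite horner_exp mulr_ge0// sqr_ge0.
    rewrite horner_exp expr2.
    over.
  by rewrite oP eqxx ltry.
have iw : mu.-integrable posR (EFin \o weight nu t).
  have /size_poly1P[c c0 P0E] : size (P 0 t) == 1 by rewrite sP.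
  apply: eq_integrable (integrableZl _ (c ^- 2) (i2 0%N)) => // x _.
  by rewrite /= P0E -EFinM horner_exp hornerC mulrA mulVf ?mul1r// expf_neq0.
have iP n : mu.-integrable posR
    (EFin \o (fun x => (P n t).[x] * weight nu t x)).
  apply: le_integrable (integrableD _ iw (i2 n)) => //.
  move=> x _ /=; rewrite lee_fin normrM (ger0_norm (w0 x)).
  rewrite -{2}[weight nu t x]mul1r -mulrDl normrM (ger0_norm (w0 x)) ler_wpM2r//.
  rewrite horner_exp (le_trans _ (ler_norm _))//.
  set y := (P n t).[x]; have := sqr_ge0 (`|y| - 1); have := real_normK (num_real y).
  by have := normr_ge0 y; nra.
apply: (graded_poly_ind sP
  (S := fun q => mu.-integrable posR (EFin \o (fun x => q.[x] * weight nu t x)))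
  _ _ _ (leqnn (size p))) => //.
- apply: eq_integrable (integrable0 mu posR) => // x _.
  by rewrite /= horner0 mul0r.
- move=> c q1 q2 i1 i2'.
  apply: eq_integrable (integrableD _ (integrableZl _ c i1) i2') => // x _.
  by rewrite /= -EFinM -EFinD hornerD hornerZ; congr _%:E; ring.
Qed.

Lemma wint_orthonormal t n m : 0 < t -> wint nu t (P n t * P m t) = (n == m)%:R.
Proof.
move=> t0; have [_ oP _] := hP t0; rewrite /wint /Rintegral.
under eq_integral do rewrite hornerM.
by rewrite oP.
Qed.

Lemma size_P t n : 0 < t -> size (P n t) = n.+1.
Proof. by move=> t0; have [] := hP t0. Qed.

Lemma top_coef_neq0 t n : 0 < t -> top_coef P n t != 0.
Proof.
by move=> t0; apply: (graded_coef_neq0 (P := P^~ t)) => k; exact: size_P.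
Qed.

Lemma wint_orthogonal_lower t n (q : {poly R}) : 0 < t -> (size q <= n)%N ->
  wint nu t (P n t * q) = 0.
Proof.
move=> t0; have fm := orthonormal_finite_moments t0.
apply: (graded_poly_ind (P := P^~ t) _ (S := fun q => wint nu t (P n t * q) = 0)).
- by move=> k; exact: size_P.
- by rewrite mulr0 wint0.
- by move=> c p q' p0 q0; rewrite mulrDr -scalerAr wint_linear// p0 q0 mulr0 addr0.
- by move=> i ni; rewrite wint_orthonormal// gtn_eqF.
Qed.

(** Only the component of [q] along [P_n] contributes, and it is read off from the
    top coefficient. *)
Lemma wint_top_coef t n (q : {poly R}) : 0 < t -> (size q <= n.+1)%N ->
  wint nu t (P n t * q) = q`_n / top_coef P n t.
Proof.
move=> t0 sq; have fm := orthonormal_finite_moments t0.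
rewrite -{1}[q](subrK ((q`_n / top_coef P n t) *: P n t)) addrC mulrDr -scalerAr.
rewrite wint_linear// wint_orthonormal// eqxx mulr1 wint_orthogonal_lower ?addr0//.
by apply: (size_sub_top (P := P^~ t)) => // k; exact: size_P.
Qed.

(** By [wint_top_coef], orthogonality to [P_(n-1)], [P_(n-2)], ... kills the
    coefficients of [q] one after the other from the top. *)
Lemma orthogonal_eq0 t n (q : {poly R}) : 0 < t -> (size q <= n)%N ->
  (forall m, (m < n)%N -> wint nu t (P m t * q) = 0) -> q = 0.
Proof.
move=> t0; elim: n => [|n ih] sq oq.
  by apply/eqP; rewrite -size_poly_eq0 -leqn0.
apply: ih => [|m mn]; last by apply: oq; exact: ltnW.
apply: size_cancel_top => //; have /eqP := oq n (ltnSn n).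
rewrite wint_top_coef// mulf_eq0 invr_eq0 (negbTE (top_coef_neq0 _ t0)) orbF.
by move/eqP.
Qed.

Hypothesis hC1 : C1_coefs P.

Definition dtP n t : {poly R} := \poly_(k < n.+1) derive1 (coef_fun P n k) t.

Lemma coef_derive_dtP n t : 0 < t -> coef_derive (P n) t (dtP n t).
Proof.
move=> t0 k; rewrite coef_poly; case: ltnP => nk.
  have [d _] := @hC1 n k t nk t0; rewrite derive1E.
  exact: (derivableP d).
apply: (@near_eq_is_derive _ _ _ (cst 0)).
near=> s; have s0 : 0 < s by near: s; exact: lt_nbhsr.
by rewrite nth_default// size_P.
Unshelve. all: by end_near. Qed.

(** The Euler operator [t d/dt + x d/dx] applied to [P_n]. *)
Definition eulerD n t : {poly R} := t *: dtP n t + 'X * (P n t)^`().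

Lemma coef_eulerD n t k : (eulerD n t)`_k = t * (dtP n t)`_k + (P n t)`_k * k%:R.
Proof.
rewrite coefD coefZ coefXM; congr (_ + _).
by case: k => [|k] /=; rewrite ?mulr0// coef_deriv mulr_natr.
Qed.

Lemma size_eulerD n t : 0 < t -> (size (eulerD n t) <= n.+1)%N.
Proof.
move=> t0; apply/leq_sizeP => k nk; rewrite coef_eulerD.
by rewrite coef_poly ltnNge nk/= nth_default ?size_P// mulr0 mul0r addr0.
Qed.

(** Differentiate the constant function [t |-> L_t(P_n P_m) = 0]; the term
    [L_t(P_n (D P_m))] drops out because [D P_m] has degree less than [n]. *)
Lemma wint_eulerD t n m : 0 < t -> (m < n)%N ->
  wint nu t (P m t * eulerD n t) = wint nu t (P n t * ('X * P m t)).
Proof.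
move=> t0 mn; have fm s s0 := @orthonormal_finite_moments s s0.
have fmt := fm _ t0.
have d0 := is_derive_wint (N := (n + m).+1) t0 fm _
  (coef_deriveM (coef_derive_dtP n t0) (coef_derive_dtP m t0)).
have /d0{}d0 s : 0 < s -> (size (P n s * P m s)%R <= (n + m).+1)%N.
  by move=> s0; rewrite (leq_trans (size_polyMleq _ _))// !size_P// addSn addnS.
have dc : is_derive t (1 : R) (fun s => wint nu s (P n s * P m s)) 0.
  apply: (@near_eq_is_derive _ _ _ (cst 0)).
  near=> s; have s0 : 0 < s by near: s; exact: lt_nbhsr.
  by rewrite wint_orthonormal// gtn_eqF.
have := @derive_val _ _ _ _ _ _ _ d0.
rewrite (@derive_val _ _ _ _ _ _ _ dc) wint_orthonormal// gtn_eqF// mulr0 addr0.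
move=> /esym E.
have wD a b : wint nu t (a + b) = wint nu t a + wint nu t b.
  by rewrite -{1}[a]scale1r wint_linear// mul1r.
have wE : wint nu t (P m t * eulerD n t) + wint nu t (P n t * eulerD m t) =
    t * wint nu t (dtP n t * P m t + P n t * dtP m t)
    + wint nu t ('X * (P n t * P m t)^`()).
  rewrite -wD -wint_linear//; congr (wint nu t).
  by rewrite /eulerD derivM -!mul_polyC; ring.
have : t * 0 = wint nu t (P m t * eulerD n t) + wint nu t (P n t * eulerD m t)
    - wint nu t ('X * (P n t * P m t)).
  by rewrite wE -{1}E; field; rewrite gt_eqF.
rewrite mulr0 (wint_orthogonal_lower (n := n) t0); last first.
  by rewrite (leq_trans (size_eulerD _ t0)).
rewrite addr0 => /esym/eqP; rewrite subr_eq0 => /eqP ->.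
by congr (wint nu t); ring.
Unshelve. all: by end_near. Qed.

(** The difference of the two sides has degree less than [n], and it is
    orthogonal to [P_m] for [m < n] by [wint_eulerD] and [wint_top_coef]. *)
Lemma eulerDE n t : 0 < t ->
  eulerD n t =
    (t * (derive1 (top_coef P n) t / top_coef P n t) + n%:R) *: P n t
    + ratioA P n t *: prevP P n t.
Proof.
move=> t0; have fm := orthonormal_finite_moments t0.
set a := (X in X *: P n t); set r := _ *: prevP P n t.
have sr : (size r <= n)%N.
  rewrite (leq_trans (size_scale_leq _ _))//.
  by case: (n) => [|k]; rewrite /= ?size_poly0// size_P.
apply/eqP; rewrite -subr_eq0; apply/eqP; apply: (orthogonal_eq0 (n := n) t0).
  apply: size_cancel_top.
    rewrite (leq_trans (size_polyD _ _))// geq_max size_eulerD//= size_polyN.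
    rewrite (leq_trans (size_polyD _ _))// geq_max (leq_trans sr)// andbT.
    by rewrite (leq_trans (size_scale_leq _ _))// size_P.
  (* the factor of [P_n] is chosen so that the top coefficients cancel *)
  rewrite coefB coef_eulerD coefD (leq_sizeP _ _ sr)// addr0 coefZ coef_poly ltnSn.
  rewrite /a -/(top_coef P n) -[(P n t)`_n]/(top_coef P n t).
  by field; exact: top_coef_neq0.
move=> m mn.
rewrite opprD addrCA mulrDr -scaleNr -scalerAr wint_linear//.
rewrite wint_orthonormal// (ltn_eqF mn) mulr0 add0r addrC -scaleN1r.
rewrite mulrDr -scalerAr wint_linear//.
rewrite wint_eulerD// wint_top_coef//; last first.
  by rewrite (leq_trans (size_polyMleq _ _))// size_polyX size_P.
rewrite /r; case: n mn {sr a r} => // n mn.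
rewrite coefXM/= -scalerAr -[_ *: (_ * _)]addr0 wint_linear//.
rewrite wint_orthonormal// wint0//.
(* [wint_top_coef] gives the coefficient of degree [n] of [P_m]: [a_n] or zero *)
have [->|nm] := eqVneq m n.
  by rewrite mulr1 addr0 mulN1r addNr.
rewrite mulr0 addr0 mulr0 add0r nth_default ?mul0r// size_P//.
by rewrite ltn_neqAle nm -ltnS.
Qed.

End Orthonormal.

Theorem theorem2 (R : realType) (nu : R) (P : nat -> R -> {poly R})
    (hP : orthonormal_family nu P) (hC1 : C1_coefs P)
    (t : R) (ht : 0 < t) (n : nat) (x : R) :
  t * derive1 (fun s : R => (P n s).[x]) t
    + x * derive1 (fun y : R => (P n t).[y]) x
  = (t * (derive1 (top_coef P n) t / top_coef P n t) + n%:R) * (P n t).[x]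
    + ratioA P n t * (prevP P n t).[x].
Proof.
have sP s : 0 < s -> (size (P n s) <= n.+1)%N by move=> s0; rewrite (size_P hP).
have dt := is_derive_horner_coef ht sP (coef_derive_dtP hP hC1 n ht) x.
have -> : derive1 (fun s : R => (P n s).[x]) t = (dtP P n t).[x].
  by rewrite derive1E; exact: derive_val.
have -> : derive1 (fun y : R => (P n t).[y]) x = (P n t)^`().[x].
  by rewrite derivE.
rewrite -hornerZ -[x in x * _]hornerX -hornerM -hornerD -/(eulerD P n t).
by rewrite (eulerDE hP hC1 n ht) hornerD !hornerZ.
Qed.
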